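(* There exist connected graphs $G$ and $H$ such that $H$ is a spanning subgraph of $G$ and $src^\ell(G)>src^\ell(H)$.
   Context: All graphs are finite, simple and undirected. An edge-coloured path is rainbow if all its edges have distinct colours; a geodesic is a shortest path between its endpoints. An (not necessarily proper) edge-colouring of a connected graph is strongly rainbow connected if any two vertices are joined by a rainbow geodesic. An $r$-edge-list assignment of $G$ assigns to each edge $e$ a set $L(e)\subset\mathbb N$ with $|L(e)|\ge r$; an $L$-edge-colouring is an edge-colouring $c$ with $c(e)\in L(e)$ for all $e$. $src^\ell(G)$ is the minimum integer $r$ such that for every $r$-edge-list assignment $L$ of $G$ there exists a strongly rainbow connected $L$-edge-colouring of $G$. *)

(* Defs.v *)
From HB Require Import structures.
From mathcomp Require Import all_boot.
From mathcomp Require Import boolp classical_sets cardinality.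

Set Implicit Arguments.
Unset Strict Implicit.
Unset Printing Implicit Defensive.

Local Open Scope card_scope.

Record sgraph (T : finType) := SGraph {
  adj :> rel T;
  adj_sym : symmetric adj;
  adj_irr : irreflexive adj
}.

Section Graph.
Variable T : finType.
Implicit Types (G H : sgraph T) (x y : T) (p : seq T) (e : {set T}).

Definition edges G : {set {set T}} :=
  [set e | [exists x, exists y, adj G x y && (e == [set x; y]%SET)]]%SET.

Definition connected_graph G : Prop :=
  0 < #|T| /\ forall x y, connect (adj G) x y.

Definition spanning_subgraph H G : Prop := edges H \subset edges G.

(* The path with vertex sequence [x :: p]. *)
Definition gpath G x y p : Prop :=
  [/\ path (adj G) x p, last x p = y & uniq (x :: p)].

Definition geodesic G x y p : Prop :=
  gpath G x y p /\ forall q, gpath G x y q -> size p <= size q.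

Definition path_edges x p : seq {set T} := pairmap (fun u v => [set u; v]%SET) x p.

(* Colourings and list assignments are total functions on vertex sets; only
   their values on [edges G] matter. *)
Definition rainbow (c : {set T} -> nat) x p : Prop := uniq (map c (path_edges x p)).

Definition strongly_rainbow_connected G (c : {set T} -> nat) : Prop :=
  forall x y, exists2 p, geodesic G x y p & rainbow c x p.

(* Lists are arbitrary, possibly infinite, sets of naturals. *)
Definition edge_list_assignment G (r : nat) (L : {set T} -> set nat) : Prop :=
  forall e, e \in edges G -> (`I_r)%classic #<= L e.

Definition list_edge_colouring G (L : {set T} -> set nat) (c : {set T} -> nat) : Prop :=
  forall e, e \in edges G -> L e (c e).

Definition src_choosable G (r : nat) : Prop :=
  forall L, edge_list_assignment G r L ->
  exists2 c, list_edge_colouring G L c & strongly_rainbow_connected G c.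

Definition is_src_list G (r : nat) : Prop :=
  src_choosable G r /\ forall s, src_choosable G s -> r <= s.

End Graph.

(* Main.v *)
Require Import Defs.
From mathcomp Require Import all_boot.
From mathcomp Require Import boolp classical_sets cardinality.
From mathcomp Require Import zify.

Set Implicit Arguments.
Unset Strict Implicit.
Unset Printing Implicit Defensive.

(** [H] consists of the two triangles 4-6-7 and 5-6-7, with a pendant vertex 0
at 4, a pendant vertex 1 at 5 and two pendant vertices 2, 3 at 7; [G] is [H]
plus the edge 07.

Two edges get different colours as soon as some pair of vertices is joined by
a unique geodesic and this geodesic contains both.  In [G] the five edges 07,
57, 15, 27, 37 are pairwise in this situation, so 4 colours do not suffice.
In [H] the vertices 0 and 1 are at distance 4 and may also be joined through 6;
fix one geodesic for each pair of vertices and let two edges conflict when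
they lie on a common fixed geodesic.  The edges of [H] can be ordered so that
each conflicts with at most three earlier ones, hence lists of size 4 suffice
by greedy colouring.  The same two arguments give the exact values 4 and 5. *)

(** * Greedy colouring from lists *)

Lemma large_set_fresh (A : set nat) (r : nat) (s : seq nat) :
  (`I_r #<= A)%card -> size s < r -> exists2 x, A x & x \notin s.
Proof.
(* Pigeonhole on [r] distinct elements of [A], which may itself be infinite. *)
move=> /pcard_leP/injfunPex[f fA f_inj] ltsr; apply: contrapT => nofresh.
have sub : {subset map f (iota 0 r) <= s}.
  move=> _ /mapP[i + ->]; rewrite mem_iota /= add0n => ltir.
  apply: contrapT => fi; apply: nofresh; exists (f i); last by apply/negP.
  exact: fA.
have uf : uniq (map f (iota 0 r)).
  rewrite map_inj_in_uniq ?iota_uniq // => i j; rewrite !mem_iota /= !add0n.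
  by move=> lti ltj; apply: f_inj; rewrite inE.
by have := uniq_leq_size uf sub; rewrite size_map size_iota leqNgt ltsr.
Qed.

(* The head of the list is coloured last. *)
Fixpoint degenerate (K : eqType) (conf : rel K) (r : nat) (s : seq K) : bool :=
  if s is a :: s' then (count (conf a) s' < r) && degenerate conf r s'
  else true.

(** Induction on [s]: the head conflicts with fewer than [r] members of the tail, so its list keeps
    a colour that none of them uses. *)
Lemma greedy_list_colouring (K : eqType) (conf : rel K) (r : nat)
    (L : K -> set nat) (s : seq K) :
  symmetric conf -> degenerate conf r s ->
  {in s, forall a, (`I_r #<= L a)%card} ->
  exists2 c : K -> nat, {in s, forall a, L a (c a)} &
    {in s &, forall a b, a != b -> conf a b -> c a != c b}.
Proof.
move=> conf_sym; elim: s => [|a s IH] /=; first by exists (fun=> 0).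
move=> /andP[lt_r deg_s] listL.
have [|c cL cconf] := IH deg_s.
  by move=> b sb; apply: listL; rewrite inE sb orbT.
have [|x Lx xP] := @large_set_fresh _ _ (map c (filter (conf a) s))
  (listL a (mem_head _ _)).
  by rewrite size_map size_filter.
have fresh b : b \in s -> conf a b -> x != c b.
  move=> sb ab; apply: contraNneq xP => ->.
  by apply/mapP; exists b; rewrite ?mem_filter ?ab.
exists (fun b => if b == a then x else c b) => [b|b b'].
  by rewrite inE; case: eqVneq => [->|_ /= /cL].
rewrite !inE; case: (eqVneq b a) => [-> _|ba /= sb];
  case: (eqVneq b' a) => [->|b'a /= sb']; rewrite ?eqxx //.
- by move=> _; apply: fresh.
- by move=> _ _; rewrite conf_sym eq_sym; apply: fresh.
- exact: cconf.
Qed.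

(** Carries a colouring of pairs of numbers over to the vertex sets that encode the edges. *)
Lemma extend_along_injection (K V : eqType) (h : K -> V) (s : seq K)
    (c : K -> nat) :
  {in s &, injective h} -> exists c', {in s, forall a, c' (h a) = c a}.
Proof.
move=> h_inj.
(* Each [e] takes the colour of its first preimage in [s]; the value 0 is a default off the
   image. *)
exists (fun e => if [seq a <- s | h a == e] is a :: _ then c a else 0) => a sa.
case def_t: [seq b <- s | h b == h a] => [|b t].
  have: a \in [seq b <- s | h b == h a] by rewrite mem_filter eqxx.
  by rewrite def_t.
have: b \in [seq b <- s | h b == h a] by rewrite def_t mem_head.
by rewrite mem_filter => /andP[/eqP hb sb]; rewrite (h_inj b a).
Qed.

Lemma uniq_map_inj_in (K V : eqType) (f : K -> V) (s : seq K) :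
  uniq (map f s) -> {in s &, injective f}.
Proof.
elim: s => //= a s IH /andP[a_s us] b b'.
rewrite !inE => /predU1P[->|sb] /predU1P[->|sb'] // eq_f; last exact: IH.
- by rewrite eq_f map_f in a_s.
- by rewrite -eq_f map_f in a_s.
Qed.

(** * Graphs on [{0, .., n}] given by lists of edges *)

(** Sorting the endpoints gives each unordered pair one normal form, so that edges can be compared
    by computation. *)
Definition nedge (u v : nat) : nat * nat := (minn u v, maxn u v).

Lemma nedgeC u v : nedge u v = nedge v u.
Proof. by rewrite /nedge minnC maxnC. Qed.

Definition nadj (E : seq (nat * nat)) : rel nat :=
  fun u v => (u != v) && (nedge u v \in E).

Definition nedges (x : nat) (p : seq nat) : seq (nat * nat) :=
  pairmap nedge x p.

Lemma nedges_mem E x p : path (nadj E) x p -> {subset nedges x p <= E}.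
Proof.
elim: p x => //= v p IH x /andP[/andP[_ xv] pp] a.
by rewrite inE => /orP[/eqP -> //|]; apply: IH.
Qed.

Section ListedGraph.

Variables (n : nat) (E : seq (nat * nat)).

Notation V := 'I_n.+1.

Definition listed_adj : rel V := fun x y => nadj E x y.

Fact listed_adj_sym : symmetric listed_adj.
Proof. by move=> x y; rewrite /listed_adj /nadj eq_sym nedgeC. Qed.

Fact listed_adj_irr : irreflexive listed_adj.
Proof. by move=> x; rewrite /listed_adj /nadj eqxx. Qed.

Definition listed_graph : sgraph V := SGraph listed_adj_sym listed_adj_irr.

Definition edge_set (a : nat * nat) : {set V} := [set inord a.1; inord a.2]%SET.

Lemma edge_set_nedge (x y : V) : edge_set (nedge x y) = [set x; y]%SET.
Proof.
rewrite /edge_set /nedge /=; case: (leqP x y) => xy; rewrite !inord_val //.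
exact: finset.setUC.
Qed.

Lemma path_edges_nedges (x : V) (p : seq V) :
  path_edges x p = map edge_set (nedges x (map val p)).
Proof. by elim: p x => //= y p IH x; rewrite edge_set_nedge IH. Qed.

Definition wf_edges : bool := all (fun a => a.1 < a.2 < n.+1) E.

Lemma edge_set_inj : wf_edges -> {in E &, injective edge_set}.
Proof.
move=> /allP wf [a b] [a' b'] /wf/= /andP[ab bn] /wf/= /andP[ab' bn'] /setP eq_e.
(* Equality of two edges is tested at the four endpoints; the order inside each pair then settles it
   by arithmetic. *)
have memE k : k < n.+1 -> (k == a) || (k == b) = (k == a') || (k == b').
  move=> kn; move: (eq_e (inord k)).
  by rewrite !inE -!val_eqE /= !inordK //; apply: ltn_trans; eassumption.
have := memE a; have := memE b; have := memE a'; have := memE b'.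
rewrite !eqxx ?orbT /= => Hb' Ha' Hb Ha.
have [-> ->] : a = a' /\ b = b' by lia.
by [].
Qed.

Lemma edge_set_edges a : wf_edges -> a \in E -> edge_set a \in edges listed_graph.
Proof.
move=> /allP wf Ea; have /andP[lt_a a2] := wf a Ea.
have a1 : a.1 < n.+1 by apply: ltn_trans a2.
rewrite inE; apply/existsP; exists (inord a.1); apply/existsP; exists (inord a.2).
rewrite eqxx andbT /= /listed_adj /nadj !inordK // neq_ltn lt_a /=.
have le_a := ltnW lt_a.
by rewrite /nedge (minn_idPl le_a) (maxn_idPr le_a) -surjective_pairing.
Qed.

Lemma edgesP e : e \in edges listed_graph -> exists2 a, a \in E & e = edge_set a.
Proof.
rewrite inE => /existsP[x /existsP[y /andP[/andP[_ xy] /eqP ->]]].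
by exists (nedge x y); rewrite ?edge_set_nedge.
Qed.

(** * Certificates for geodesics *)

Definition vertices : seq nat := iota 0 n.+1.

Lemma val_vertices (x : V) : (x : nat) \in vertices.
Proof. by rewrite mem_iota /= add0n ltn_ord. Qed.

(* [geo x y] lists the vertices following [x] on the chosen geodesic to [y]. *)
Variable geo : nat -> nat -> seq nat.

Definition is_route (x y : nat) (p : seq nat) : bool :=
  [&& path (nadj E) x p, last x p == y, uniq (x :: p), uniq (nedges x p)
    & all (gtn n.+1) p].

(* The last conjunct says that the length of [geo x] is 1-Lipschitz, hence that
   it is a lower bound for the distance from [x]. *)
Definition routing : bool :=
  all (fun x => (geo x x == [::]) && all (fun y => is_route x y (geo x y)
    && all (fun z => nadj E y z ==> (size (geo x z) <= (size (geo x y)).+1))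
         vertices) vertices) vertices.

Hypothesis geoP : routing.

Lemma geo_route (x y : V) : is_route x y (geo x y).
Proof.
move/allP: geoP => /(_ _ (val_vertices x)) /andP[_ /allP].
by move=> /(_ _ (val_vertices y)) /andP[].
Qed.

Lemma geo_nil (x : V) : geo x x = [::].
Proof. by move/allP: geoP => /(_ _ (val_vertices x)) /andP[/eqP]. Qed.

Lemma geo_lipschitz (x y z : V) :
  listed_adj y z -> size (geo x z) <= (size (geo x y)).+1.
Proof.
move=> yz; move/allP: geoP => /(_ _ (val_vertices x)) /andP[_ /allP].
move=> /(_ _ (val_vertices y)) /andP[_ /allP /(_ _ (val_vertices z))].
by move=> /implyP; apply.
Qed.

Lemma geo_min (x y : V) p :
  path listed_adj y p -> size (geo x (last y p)) <= size (geo x y) + size p.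
Proof.
elim: p y => [|z p IH] y /=; first by rewrite addn0.
move=> /andP[/(geo_lipschitz x) yz /IH le_zp].
by rewrite addnS -addSn; apply: leq_trans le_zp _; rewrite leq_add2r.
Qed.

Definition lift_geo (x y : V) : seq V := map inord (geo x y).

Lemma val_lift_geo (x y : V) : map val (lift_geo x y) = geo x y.
Proof.
rewrite /lift_geo -map_comp; have /and5P[_ _ _ _ /allP lt_geo] := geo_route x y.
by rewrite -[RHS]map_id; apply/eq_in_map => k /lt_geo lt_k; rewrite /= inordK.
Qed.

Lemma lift_geo_gpath (x y : V) : gpath listed_graph x y (lift_geo x y).
Proof.
have /and5P[pp /eqP lp up _ _] := geo_route x y.
rewrite -(val_lift_geo x y) in pp lp up; split.
- by rewrite path_map in pp.
- by apply: val_inj; rewrite last_map in lp.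
- by rewrite -map_cons (map_inj_uniq val_inj) in up.
Qed.

Lemma lift_geo_geodesic (x y : V) : geodesic listed_graph x y (lift_geo x y).
Proof.
split=> [|q [pq lq _]]; first exact: lift_geo_gpath.
by rewrite size_map; have := geo_min x pq; rewrite lq geo_nil.
Qed.

Lemma listed_connected : connected_graph listed_graph.
Proof.
split=> [|x y]; first by rewrite card_ord.
have [pp lp _] := lift_geo_gpath x y.
by apply/connectP; exists (lift_geo x y).
Qed.

Lemma geodesic_size (x y : V) p :
  geodesic listed_graph x y p -> size p = size (geo x y).
Proof.
move=> [[pp lp up] minp]; apply/eqP; rewrite eqn_leq; apply/andP; split.
  by have := minp _ (lift_geo_gpath x y); rewrite size_map.
by have := geo_min x pp; rewrite lp geo_nil.
Qed.

(** * Upper bound from one fixed geodesic per pair *)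

Definition conflict : rel (nat * nat) :=
  fun a b => has (fun x => has (fun y =>
    (a \in nedges x (geo x y)) && (b \in nedges x (geo x y))) vertices) vertices.

Lemma conflict_sym : symmetric conflict.
Proof. by move=> a b; apply: eq_has => x; apply: eq_has => y; apply: andbC. Qed.

Lemma listed_choosable r :
  wf_edges -> degenerate conflict r E -> src_choosable listed_graph r.
Proof.
move=> wf deg L listL.
have [|c0 c0L c0conf] := @greedy_list_colouring _ _ _ (L \o edge_set) _
  conflict_sym deg.
  by move=> a Ea; apply/listL/edge_set_edges.
have [c cE] := extend_along_injection c0 (edge_set_inj wf).
exists c => [e /edgesP[a Ea ->]|x y]; first by rewrite cE //; apply: c0L.
exists (lift_geo x y); first exact: lift_geo_geodesic.
rewrite /rainbow path_edges_nedges val_lift_geo -map_comp.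
have /and5P[pp _ _ up _] := geo_route x y.
have subE := nedges_mem pp.
rewrite map_inj_in_uniq // => a b pa pb /=; rewrite !cE ?subE // => eq_c.
apply: contra_eq eq_c => ab.
apply: c0conf; rewrite ?subE //.
apply/hasP; exists (x : nat); first exact: val_vertices.
by apply/hasP; exists (y : nat); rewrite ?val_vertices ?pa.
Qed.

(** * Forced conflicts *)

(** Repeated vertices are allowed: any finite list containing all geodesics of length [k] from [x]
    serves. *)
Fixpoint walks (k x : nat) : seq (seq nat) :=
  if k is k'.+1 then
    flatten [seq map (cons v) (walks k' v) | v <- vertices & nadj E x v]
  else [:: [::]].

Lemma mem_walks (x : V) (p : seq V) :
  path listed_adj x p -> map val p \in walks (size p) x.
Proof.
elim: p x => // y p IH x /andP[xy pp]; rewrite map_cons.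
apply/flattenP; exists (map (cons (y : nat)) (walks (size p) y)).
  apply/mapP; exists (y : nat) => //; rewrite mem_filter val_vertices andbT.
  exact: xy.
by apply/mapP; exists (map val p); first exact: IH.
Qed.

(** Several geodesics from [x] to [y] are permitted, provided that all of them use both edges. *)
Definition forced : rel (nat * nat) :=
  fun a b => has (fun x => has (fun y =>
    all (fun p => (last x p == y) ==> (a \in nedges x p) && (b \in nedges x p))
      (walks (size (geo x y)) x)) vertices) vertices.

Lemma forced_neq c a b :
  strongly_rainbow_connected listed_graph c -> a != b -> forced a b ->
  c (edge_set a) != c (edge_set b).
Proof.
move=> rc ab /hasP[x xn /hasP[y yn /allP allp]].
rewrite !mem_iota /= !add0n in xn yn.
have [p geo_p rb_p] := rc (Ordinal xn) (Ordinal yn).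
have [[pp lp _] _] := geo_p.
(* The rainbow geodesic has the length of [geo x y], so it occurs in the enumeration and contains
   [a] and [b]. *)
have := allp _; rewrite -(geodesic_size geo_p) => /(_ _ (mem_walks pp)).
rewrite (last_map val p (Ordinal xn)) lp eqxx /= => /andP[pa pb].
rewrite /rainbow path_edges_nedges -map_comp in rb_p.
apply: contraNneq ab => eq_c.
exact/eqP/(uniq_map_inj_in rb_p).
Qed.

Lemma forced_clique_bound (C : seq (nat * nat)) s :
  wf_edges -> all (mem E) C -> pairwise (fun a b => (a != b) && forced a b) C ->
  src_choosable listed_graph s -> size C <= s.
Proof.
(* With the constant list of [s] colours, the edges of [C] need distinct colours below [s]. *)
move=> wf /allP CE CP /(_ (fun=> `I_s)%classic)[|c cL rc].
  by move=> e _; apply: card_lexx.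
have uC : uniq (map (c \o edge_set) C).
  rewrite uniq_pairwise pairwise_map; apply: sub_pairwise CP => a b /andP[ab ab_f].
  exact: forced_neq.
rewrite -(size_map (c \o edge_set) C) -(size_iota 0 s); apply: uniq_leq_size => //.
move=> _ /mapP[a /CE Ea ->]; rewrite mem_iota add0n /=.
by apply: cL; apply: edge_set_edges.
Qed.

End ListedGraph.

(** * The two concrete graphs *)

Lemma listed_spanning n E F :
  wf_edges n E -> wf_edges n F -> {subset E <= F} ->
  spanning_subgraph (listed_graph n E) (listed_graph n F).
Proof.
move=> wfE wfF EF; apply/fintype.subsetP => e /edgesP[a Ea ->].
by apply: edge_set_edges => //; apply: EF.
Qed.

(* The segment from [x] to [y] of the first sequence of [W] containing both,
   without [x]. *)
Definition segment (W : seq (seq nat)) (x y : nat) : seq nat :=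
  let w := nth [::] W (find (fun w => (x \in w) && (y \in w)) W) in
  let i := index x w in let j := index y w in
  behead (if i <= j then take (j - i).+1 (drop i w)
          else rev (take (i - j).+1 (drop j w))).

(** Listed in reverse greedy order: the pendant edges come last and are coloured first. *)
Definition edgesH : seq (nat * nat) :=
  [:: (6, 7); (5, 6); (4, 6); (5, 7); (4, 7); (3, 7); (2, 7); (1, 5); (0, 4)].

Definition edgesG : seq (nat * nat) := (0, 7) :: edgesH.

(** Going from 0 to 1 through 6 keeps 47 and 57 out of conflict; through 7, the six edges 04, 47,
    57, 15, 27, 37 would conflict pairwise. *)
Definition geoH : nat -> nat -> seq nat :=
  segment [:: [:: 0; 4; 6; 5; 1]; [:: 0; 4; 7; 2]; [:: 0; 4; 7; 3];
              [:: 1; 5; 7; 2]; [:: 1; 5; 7; 3]; [:: 2; 7; 3];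
              [:: 6; 7; 2]; [:: 6; 7; 3]].

Definition geoG : nat -> nat -> seq nat :=
  segment [:: [:: 0; 7; 5; 1]; [:: 0; 7; 2]; [:: 0; 7; 3]; [:: 0; 4; 6];
              [:: 4; 6; 5; 1]; [:: 4; 7; 2]; [:: 4; 7; 3];
              [:: 1; 5; 7; 2]; [:: 1; 5; 7; 3]; [:: 2; 7; 3];
              [:: 6; 7; 2]; [:: 6; 7; 3]].

Lemma routing_geoH : routing 7 edgesH geoH.
Proof. by vm_compute. Qed.

Lemma routing_geoG : routing 7 edgesG geoG.
Proof. by vm_compute. Qed.

Lemma src_list_H : is_src_list (listed_graph 7 edgesH) 4.
Proof.
split; first by apply: (listed_choosable routing_geoH); vm_compute.
(* The four pendant edges: both geodesics from 0 to 1 use 04 and 15. *)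
move=> s; apply: (@forced_clique_bound _ _ _ routing_geoH
  [:: (0, 4); (1, 5); (2, 7); (3, 7)]); by vm_compute.
Qed.

Lemma src_list_G : is_src_list (listed_graph 7 edgesG) 5.
Proof.
split; first by apply: (listed_choosable routing_geoG); vm_compute.
move=> s; apply: (@forced_clique_bound _ _ _ routing_geoG
  [:: (0, 7); (5, 7); (1, 5); (2, 7); (3, 7)]); by vm_compute.
Qed.

Theorem theorem2p2 :
  exists (T : finType) (G H : sgraph T),
    [/\ connected_graph G, connected_graph H, spanning_subgraph H G
      & exists rG rH : nat,
          [/\ is_src_list G rG, is_src_list H rH & rG > rH]].
Proof.
exists 'I_8, (listed_graph 7 edgesG), (listed_graph 7 edgesH); split.
- exact: listed_connected routing_geoG.
- exact: listed_connected routing_geoH.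
- by apply: listed_spanning => // a; rewrite [a \in edgesG]inE => ->; rewrite orbT.
- by exists 5, 4; split=> //; [exact: src_list_G | exact: src_list_H].
Qed.
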